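(* Let $(T,\mathcal{L})$ be an instance of Hyper-TAP with costs $c$, let $U$ be an up-link solution with costs $c:U\to\mathbb{R}_{\ge 0}$ such that the sets $P_u$, $u\in U$, are pairwise edge-disjoint, and let $F^*\subseteq\mathcal{L}$ be any feasible solution. Then for every $\varepsilon>0$, setting $k=\lceil 1/\varepsilon\rceil$, there exist a partition $\mathcal{Z}$ of $F^*$ and a set $O\subseteq U$ such that: (i) every $Z\in\mathcal{Z}$ is $k$-thin; (ii) $c(O)\le\varepsilon\cdot c(U)$; and (iii) $U\setminus O\subseteq\bigcup_{Z\in\mathcal{Z}}\mathrm{drop}_U(Z)$.
   Context: Hyper-TAP: given a tree $T=(V,E)$ and a collection of hyper-links $\mathcal{L}\subseteq 2^V$ with nonnegative costs. For a hyper-link $\ell$, $T_\ell$ is the union of the tree paths between pairs of vertices of $\ell$ (equivalently the union of the paths from each $a\in\ell$ to the least common ancestor of $\ell$, for a fixed root); $\ell$ covers the edges of $T_\ell$. A feasible solution is a set $Z\subseteq\mathcal{L}$ with $\bigcup_{\ell\in Z}T_\ell=E$. Fix a root of $T$; an up-link is a pair $u=(t,b)$ of vertices with $t$ an ancestor of $b$, and $P_u$ is the tree path from $t$ to $b$; an up-link solution is a set $U$ of up-links with $\bigcup_{u\in U}P_u=E$. For a set $Z$ of hyper-links, $\mathrm{drop}_U(Z)=\{u\in U: P_u\subseteq\bigcup_{\ell\in Z}T_\ell\}$. A set $Z$ of hyper-links is $k$-thin if for every vertex $v$ of $T$, $|\{\ell\in Z: v\in V(T_\ell)\}|\le k$.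 *)

(* Defs.v *)
(* MathComp; the real numbers are any realType of MathComp-Analysis. *)
From mathcomp Require Import all_boot all_order all_algebra.
From mathcomp Require Import reals.

Set Implicit Arguments.
Unset Strict Implicit.
Unset Printing Implicit Defensive.

Section HyperTAP.
Variables (V : finType) (e : rel V).

(* A simple graph is its adjacency relation; an edge is a two-element set. *)
Definition is_tree : Prop :=
  [/\ symmetric e, irreflexive e, forall x y, connect e x y
    & forall s : seq V, 2 < size s -> ~~ ucycleb e s].

Definition edges : {set {set V}} :=
  [set [set xy.1; xy.2] | xy : V * V & e xy.1 xy.2].

(* The walk from x to y through x :: p, without repeated vertices. *)
Definition simple_path (x y : V) (p : seq V) : bool :=
  [&& path e x p, uniq (x :: p) & last x p == y].

(* The vertex sequence, x first, of the path from x to y. The path is unique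
   in a tree, and the length bound is no restriction on a repetition-free
   sequence. *)
Definition tpath (x y : V) : seq V :=
  if [pick p : #|V|.-bseq V | simple_path x y p] is Some p then x :: p
  else [::].

Definition path_verts (x y : V) : {set V} := [set v in tpath x y].

Definition path_edges (x y : V) : {set {set V}} :=
  [set [set ab.1; ab.2] | ab in zip (tpath x y) (behead (tpath x y))].

(* V(T_l) and E(T_l). The pairs (a, a) are included, so that T_l is the single
   vertex a when l = {a}. *)
Definition link_verts (l : {set V}) : {set V} :=
  \bigcup_(a in l) \bigcup_(b in l) path_verts a b.

Definition link_edges (l : {set V}) : {set {set V}} :=
  \bigcup_(a in l) \bigcup_(b in l) path_edges a b.

Definition covered (Z : {set {set V}}) : {set {set V}} :=
  \bigcup_(l in Z) link_edges l.

Definition feasible (L Z : {set {set V}}) : Prop :=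
  Z \subset L /\ covered Z = edges.

Definition ancestor (r t b : V) : bool := t \in path_verts r b.

(* (t, b) with t != b: a degenerate pair (t, t) covers nothing and is not a
   link. *)
Definition up_link (r : V) (u : V * V) : bool :=
  ancestor r u.1 u.2 && (u.1 != u.2).

Definition up_path (u : V * V) : {set {set V}} := path_edges u.1 u.2.

Definition up_link_solution (r : V) (U : {set V * V}) : Prop :=
  {in U, forall u, up_link r u} /\ \bigcup_(u in U) up_path u = edges.

Definition drop_links (U : {set V * V}) (Z : {set {set V}}) : {set V * V} :=
  [set u in U | up_path u \subset covered Z].

Definition thin (k : nat) (Z : {set {set V}}) : Prop :=
  forall v : V, #|[set l in Z | v \in link_verts l]| <= k.

End HyperTAP.

(* Main.v *)
(* The up-links partition the non-root vertices c (that is, the edges {c,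
   parent c}) into vertical paths. For each up-link u choose a cover F_u of P_u
   of minimum weight, where every link has positive weight, deeper apices are
   lighter, and any link is lighter than two links together. Exactly one link
   h_u of F_u has its apex at or above the top of P_u; make h_u the parent of
   all other links of F_u. As the edge above the apex of a link lies in at most
   one P_u, this is a forest on F. Label u by the level of h_u modulo k, and let
   O be the cheapest label class. Deleting the arcs of O leaves components that
   span at most k consecutive levels. The exchange property of minimum covers
   shows that among the links of a component through a fixed vertex v, all but
   the one with the highest apex have distinct levels, none of them the level of
   the component root. Hence every component is k-thin, and the F_u with u
   outside O stay inside one component. *)
Require Import Defs.
From mathcomp Require Import all_boot all_order all_algebra.
From mathcomp Require Import reals.
Import Order.TTheory GRing.Theory Num.Theory.

Set Implicit Arguments.
Unset Strict Implicit.
Unset Printing Implicit Defensive.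

Lemma mem_cat_cons (T : eqType) (x : T) s :
  x \in s -> exists s1 s2, s = s1 ++ x :: s2.
Proof. by case/splitPr=> s1 s2; exists s1, s2. Qed.

(** * Paths in a rooted tree *)

Section RootedTree.
Variables (V : finType) (e : rel V).
Hypothesis tree_e : is_tree e.

(** A common first step is stripped by induction. If the first steps differ, [p] up to its first
    return to [q], followed by [q] backwards, closes a cycle on more than two vertices. *)
Lemma simple_path_inj x y p q :
  simple_path e x y p -> simple_path e x y q -> p = q.
Proof.
have [e_sym _ _ acyc] := tree_e.
elim: p x q => [|a p IHp] x [|b q] //.
- case/and3P=> _ _ /eqP <- /and3P[_ /= /andP[+ _] /eqP Dx].
  by rewrite -{1}Dx mem_last.
- case/and3P=> _ /= /andP[+ _] /eqP Dy /and3P[_ _ /eqP Dx]; rewrite -Dy in Dx.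
  by rewrite {1}[x]Dx mem_last.
case/and3P=> /= /andP[exa pap] /andP[x_p /andP[a_p Up]] Lp.
case/and3P=> /= /andP[exb pbq] /andP[x_q /andP[b_q Uq]] Lq.
have [Dab | neq_ab] := eqVneq a b.
  rewrite Dab in pap Lp a_p *; congr (_ :: _).
  by apply: (IHp b); apply/and3P; split=> //=; apply/andP.
have hasp : has (mem (b :: q)) (a :: p).
  apply/hasP; exists y; first by rewrite -(eqP Lp) mem_last.
  by rewrite /= -(eqP Lq) mem_last.
(* The two paths diverge at x; z is the first vertex of p back on q. *)
have : path e x (a :: p) by rewrite /= exa.
have : uniq (x :: a :: p) by rewrite /= x_p a_p.
have : path e x (b :: q) by rewrite /= exb.
have : uniq (x :: b :: q) by rewrite /= x_q b_q.
have : ohead (a :: p) != ohead (b :: q) by apply: contraNneq neq_ab => -[->].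
case/split_find: hasp => z p1 p2 zq p1q; have {}zq : z \in b :: q by [].
case/splitPr: zq p1q => q1 q2 p1q; rewrite -!cat_rcons => neq_h.
rewrite -cat_cons cat_uniq cat_path => /andP[Uq1 _] /andP[pq _].
rewrite -cat_cons cat_uniq cat_path => /andP[Up1 _] /andP[pp1 _].
have sz: 2 < size (x :: rcons p1 z ++ rev q1).
  rewrite /= size_cat size_rcons size_rev.
  by move: neq_h; case: (p1) (q1) => [|? ?] [|? ?] //=; rewrite ?eqxx ?addnS.
case/negP: (acyc _ sz); rewrite /ucycleb; apply/andP; split.
  rewrite /= rcons_cat cat_path pp1 last_rcons /=.
  have := rev_path e x (rcons q1 z).
  rewrite last_rcons belast_rcons rev_cons => ->.
  by rewrite (eq_path (e' := e)) // => ? ?; rewrite e_sym.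
rewrite -cat_cons cat_uniq Up1 rev_uniq /=.
move: Uq1; rewrite /= rcons_uniq mem_rcons inE negb_or.
case/and3P=> /andP[neq_xz xq1] zq1 ->; rewrite andbT.
apply/hasPn => c; rewrite mem_rev => cq1.
rewrite inE mem_rcons inE !negb_or.
apply/and3P; split.
- by apply: contraNneq xq1 => <-.
- by apply: contraNneq zq1 => <-.
apply: contra p1q => cp1; apply/hasP; exists c => //.
by rewrite /= mem_cat cq1.
Qed.

Lemma tpathP x y : exists2 p, tpath e x y = x :: p & simple_path e x y p.
Proof.
have [_ _ conn _] := tree_e; rewrite /tpath.
case: pickP => [p sp|none]; first by exists p.
case/connectP: (conn x y) => p0 /shortenP[p pp Up _] Dy.
have szp : size p <= #|V|.
  have := max_card (mem (x :: p)); rewrite (card_uniqP Up) /=; exact: ltnW.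
have := none (Bseq szp).
by rewrite /simple_path /= pp Dy eqxx andbT -[_ && _]/(uniq (x :: p)) Up.
Qed.

Lemma tpath_eq x y p : simple_path e x y p -> tpath e x y = x :: p.
Proof. by have [q -> sq] := tpathP x y => /(simple_path_inj sq) ->. Qed.

(** * Root paths and parents *)

Variable r : V.
Let tp := tpath e r.

Lemma tp_last x z : last z (tp x) = x.
Proof. by rewrite /tp; have [p -> /and3P[_ _ /eqP]] := tpathP r x. Qed.

Lemma mem_tp x : x \in tp x.
Proof.
by rewrite /tp; have [p -> /and3P[_ _ /eqP {1}<-]] := tpathP r x; exact: mem_last.
Qed.

Lemma mem_root_tp x : r \in tp x.
Proof. by rewrite /tp; have [p -> _] := tpathP r x; rewrite inE eqxx. Qed.

Lemma tp_prefix x s1 s2 y : tp y = s1 ++ x :: s2 -> tp x = rcons s1 x.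
Proof.
rewrite /tp; have [p -> /and3P[pp Up /eqP Ly]] := tpathP r y.
case: s1 => [|a s1] /= [Dr Dp].
  by rewrite -Dr; apply: tpath_eq; rewrite /simple_path /= eqxx.
rewrite -Dr; apply: tpath_eq; apply/and3P; split; last by rewrite last_rcons.
  by move: pp; rewrite Dp -cat_rcons cat_path => /andP[].
by move: Up; rewrite Dp -cat_rcons -cat_cons cat_uniq => /andP[].
Qed.

Lemma tp_edge x y : e x y -> tp y = rcons (tp x) y \/ tp x = rcons (tp y) x.
Proof.
have [e_sym e_irr _ _] := tree_e => exy.
have [y_x | yNx] := boolP (y \in tp x); last first.
  left; move: yNx; rewrite /tp; have [p -> /and3P[pp Up /eqP Lx]] := tpathP r x.
  move=> yNp; apply: tpath_eq; apply/and3P.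
  by rewrite rcons_path pp Lx exy last_rcons -rcons_cons rcons_uniq yNp.
right; have [s1 [s2 Dx]] := mem_cat_cons y_x.
rewrite (tp_prefix Dx) Dx -[RHS]cats1 cat_rcons; congr (_ ++ _ :: _).
apply: (@simple_path_inj y x).
  move: Dx; rewrite /tp; have [p -> /and3P[pp Up /eqP Lx]] := tpathP r x.
  move=> Dx; apply/and3P; split.
  - by case: s1 Dx pp => [[-> ->] //|a s1 [_ ->]]; rewrite cat_path /= => /and3P[].
  - by move: Up; rewrite Dx cat_uniq => /and3P[].
  by have := congr1 (last r) Dx; rewrite /= Lx last_cat /= => ->.
rewrite /simple_path /= e_sym exy eqxx !andbT inE.
by apply: contraTneq exy => ->; rewrite e_irr.
Qed.

(** The last vertex before [x] on its root path; the default makes the root its own parent. *)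
Definition tpar x := last r (take (size (tp x)).-1 (tp x)).

Lemma tparE x y : tp y = rcons (tp x) y -> tpar y = x.
Proof.
by rewrite /tpar => ->; rewrite size_rcons /= -cats1 take_size_cat // tp_last.
Qed.

Lemma tp_tpar c : c != r -> e (tpar c) c /\ tp c = rcons (tp (tpar c)) c.
Proof.
move=> neq_c; have [p Dp /and3P[pp Up /eqP Lp]] := tpathP r c.
case/lastP: p Dp pp Up Lp => [|p c'] Dp pp Up Lp.
  by rewrite -Lp eqxx in neq_c.
rewrite last_rcons in Lp; move: Dp pp Up; rewrite {}Lp rcons_path => Dp /andP[_ epc] _.
have Dx: tp c = rcons (r :: p) c by rewrite /tp Dp.
have Dl : tp (last r p) = r :: p.
  have := tp_prefix (x := last r p) (s1 := belast r p) (s2 := [:: c]) (y := c).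
  by rewrite -cat_rcons -lastI; apply; rewrite Dx -cats1.
by rewrite (@tparE (last r p)) Dl.
Qed.

Lemma tp_size c : c != r -> size (tp (tpar c)) < size (tp c).
Proof. by case/tp_tpar=> _ ->; rewrite size_rcons. Qed.

Lemma edge_par x y : e x y -> (x = tpar y /\ y != r) \/ (y = tpar x /\ x != r).
Proof.
have no_root a b: tp b = rcons (tp a) b -> b != r.
  apply: contra_eq_neq => ->; apply/eqP=> /(congr1 size); rewrite size_rcons.
  rewrite {1}/tp (@tpath_eq r r [::]) /=; last by rewrite /simple_path /= eqxx.
  by case Da: (tp a) (mem_root_tp a).
by case/tp_edge => D; [left | right]; rewrite (tparE D) (no_root _ _ D).
Qed.

(** * The ancestor order *)

Lemma ancestorE x y : ancestor e r x y = (x \in tp y).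
Proof. by rewrite /ancestor /path_verts inE. Qed.

Lemma ancestor_refl : reflexive (ancestor e r).
Proof. by move=> x; rewrite ancestorE mem_tp. Qed.

Lemma ancestor_root x : ancestor e r r x.
Proof. by rewrite ancestorE mem_root_tp. Qed.

Lemma ancestor_par c x :
  x != r -> ancestor e r c x = (c == x) || ancestor e r c (tpar x).
Proof. by case/tp_tpar=> _ Dx; rewrite !ancestorE Dx mem_rcons inE. Qed.

Lemma ancestor_take x y : ancestor e r x y ->
  exists s, tp y = tp x ++ s.
Proof.
rewrite ancestorE => /mem_cat_cons[s1 [s2 Ey]].
by exists s2; rewrite (tp_prefix Ey) cat_rcons.
Qed.

Lemma ancestor_trans : transitive (ancestor e r).
Proof.
move=> y x z; rewrite [in X in X -> _]ancestorE => xy /ancestor_take[s Ds].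
by rewrite ancestorE Ds mem_cat xy.
Qed.

Lemma ancestor_anti : antisymmetric (ancestor e r).
Proof.
move=> x y /andP[/ancestor_take[s Ds] /ancestor_take[s' Ds']].
have := congr1 size Ds; rewrite Ds' !size_cat.
rewrite -{1}[size (tp y)]addn0 -addnA => /eqP; rewrite eqn_add2l eq_sym addn_eq0.
case/andP=> /nilP s'0 _; rewrite s'0 cats0 in Ds'.
by rewrite -(tp_last x r) Ds' tp_last.
Qed.

Lemma ancestor_total x y z :
  ancestor e r x z -> ancestor e r y z -> ancestor e r x y || ancestor e r y x.
Proof.
wlog le_xy: x y / size (tp x) <= size (tp y) => [IH xz yz|].
  by case/orP: (leq_total (size (tp x)) (size (tp y))) => /IH; [|rewrite orbC]; apply.
case/ancestor_take=> s Ds /ancestor_take[s' Ds']; apply/orP; left.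
have: tp x = take (size (tp x)) (tp y).
  by rewrite -(takel_cat s' le_xy) -Ds' Ds take_size_cat.
by rewrite ancestorE => Dx; apply: (@mem_take (size (tp x))); rewrite -Dx mem_tp.
Qed.

(** * Tree edges as non-root vertices, and how paths cross them *)

Definition par_edge c := [set c; tpar c].

Lemma par_edge_inj c d : c != r -> d != r -> par_edge c = par_edge d -> c = d.
Proof.
move=> cr dr Dcd; have := set21 c (tpar c); rewrite -/(par_edge c) Dcd !inE.
case/orP=> /eqP // cpd; have := set21 d (tpar d); rewrite -/(par_edge d) -Dcd.
rewrite !inE => /orP[] /eqP // dpc.
have := tp_size cr; have := tp_size dr.
by rewrite -cpd -dpc => /ltn_trans lt /lt; rewrite ltnn.
Qed.

Lemma set2C (x y : V) : [set x; y] = [set y; x]. Proof. exact: setUC. Qed.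

Lemma edges_par_edge x : x \in edges e -> exists2 c, c != r & x = par_edge c.
Proof.
case/imsetP=> -[a b] /=; rewrite inE /= => eab ->.
by case: (edge_par eab) => -[-> ?]; [exists b | exists a]; rewrite // set2C.
Qed.

Lemma par_edge_edges c : c != r -> par_edge c \in edges e.
Proof.
case/tp_tpar=> epc _; apply/imsetP; exists (tpar c, c); last by rewrite /= set2C.
by rewrite inE.
Qed.

Lemma ancestor_step c x y : c != r -> e x y ->
  (ancestor e r c x != ancestor e r c y) = ([set x; y] == par_edge c).
Proof.
move=> cr; wlog [-> yr]: x y / x = tpar y /\ y != r => [IH exy|epy].
  case: (edge_par exy) => D; first exact: IH.
  have [e_sym _ _ _] := tree_e.
  by rewrite eq_sym set2C; apply: IH; rewrite // e_sym.
rewrite (ancestor_par c yr).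
have -> : ([set tpar y; y] == par_edge c) = (c == y).
  apply/eqP/eqP => [|->]; last by rewrite set2C.
  by rewrite set2C => /esym/par_edge_inj; apply.
case: (eqVneq c y) => [Dc|_] /=; last by rewrite eqxx.
rewrite -{}Dc.
rewrite eqb_id; apply/negP=> cp.
case: (ancestor_take cp) => s /(congr1 size) /eqP.
rewrite size_cat eqn_leq andbC => /andP[].
by rewrite leqNgt (leq_trans (tp_size cr)) ?leq_addr.
Qed.

(** A discrete intermediate value argument: [ancestor_step] identifies the first edge along which
    membership in the subtree of [c] changes. *)
Lemma path_crosses c x p :
    path e x p -> ancestor e r c x != ancestor e r c (last x p) ->
  exists p1 p2 y z, [/\ x :: p = p1 ++ [:: y, z & p2] & par_edge c = [set y; z]].
Proof.
elim: p x => [|y p IHp] x /=; first by rewrite eqxx.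
case/andP=> exy pyp neq.
have [Dxy|Nxy] := eqVneq (ancestor e r c x) (ancestor e r c y).
  rewrite Dxy in neq; have [p1 [p2 [y1 [z1 [-> D]]]]] := IHp _ pyp neq.
  by exists (x :: p1), p2, y1, z1.
have cr: c != r by apply: contraNneq Nxy => ->; rewrite !ancestor_root.
exists [::], p, x, y; split=> //.
by rewrite ancestor_step // in Nxy; rewrite -(eqP Nxy).
Qed.

Lemma mem_crosses c x p : path e x p -> ancestor e r c x != ancestor e r c (last x p) ->
  [/\ c \in x :: p & tpar c \in x :: p].
Proof.
move=> pp /(path_crosses pp)[p1 [p2 [y [z [-> D]]]]].
by split; [have: c \in par_edge c by rewrite set21
          |have: tpar c \in par_edge c by rewrite set22];
  rewrite D mem_cat !inE => /orP[] ->; rewrite ?orbT.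
Qed.

Lemma tpath_split a b v p1 p2 : tpath e a b = p1 ++ v :: p2 ->
  [/\ uniq (p1 ++ v :: p2), sorted e (rcons p1 v), sorted e (v :: p2),
      head v (rcons p1 v) = a & last v p2 = b].
Proof.
case: (tpathP a b) => p -> /and3P[pp Up /eqP Lp] Dp; rewrite -Dp; split=> //.
- by have: sorted e (a :: p) by []; rewrite Dp -cat_rcons => /cat_sorted2[].
- by have: sorted e (a :: p) by []; rewrite Dp => /cat_sorted2[].
- by case: p1 Dp => [|? ?] [].
- by have := congr1 (last v) Dp; rewrite /= Lp last_cat.
Qed.

Lemma sorted_crosses c x s : sorted e s ->
    ancestor e r c (head x s) != ancestor e r c (last x s) ->
  c \in s /\ tpar c \in s.
Proof.
by case: s => [|y s] /=; [rewrite eqxx | move=> ps /(mem_crosses ps)[]].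
Qed.

(** Cut the path at [v]. If a claim fails, both halves cross the same edge, above [x] for the first
    claim and above [v] for the second, so a vertex other than [v] is visited twice. *)
Lemma path_vertsP a b v : v \in path_verts e a b ->
  (forall x, ancestor e r x a -> ancestor e r x b -> ancestor e r x v) /\
  (ancestor e r v a \/ ancestor e r v b).
Proof.
rewrite inE => /mem_cat_cons[p1 [p2 /tpath_split[Up s1 s2 Ha Lb]]].
have twice y : y != v -> y \in rcons p1 v -> y \in v :: p2 -> False.
  rewrite mem_rcons !inE => /negPf-> /= yp1 yp2.
  move: Up; rewrite cat_uniq => /and3P[_ /hasPn/(_ y)/= + _].
  by rewrite inE yp2 orbT yp1 => /(_ isT).
split=> [x xa xb|].
  apply/negPn/negP=> xNv; apply: (twice x).
  - by apply: contraNneq xNv => ->; apply: ancestor_refl.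
  - by apply: (sorted_crosses (x := v) s1 _).1; rewrite Ha last_rcons xa (negPf xNv).
  - by apply: (sorted_crosses (x := v) s2 _).1; rewrite /= Lb xb (negPf xNv).
have [va|vNa] := boolP (ancestor e r v a); first by left.
have [vb|vNb] := boolP (ancestor e r v b); first by right.
have vr : v != r by apply: contraNneq vNa => ->; apply: ancestor_root.
case: (twice (tpar v)).
- by apply: contraTneq (tp_size vr) => ->; rewrite ltnn.
- apply: (sorted_crosses (x := v) s1 _).2.
  by rewrite Ha last_rcons ancestor_refl (negPf vNa).
- by apply: (sorted_crosses (x := v) s2 _).2; rewrite /= Lb ancestor_refl (negPf vNb).
Qed.

Lemma mem_zip_behead (T : eqType) (y z : T) s :
  (y, z) \in zip s (behead s) <-> exists p1 p2, s = p1 ++ [:: y, z & p2].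
Proof.
elim: s => [|a [|b s] IHs].
- by split=> // -[[|? ?] [? ?]].
- by split=> // -[[|? [|? ?]] [? ?]].
rewrite /= inE; split=> [/orP[/eqP[-> ->]|/IHs[p1 [p2 ->]]]|].
- by exists [::], s.
- by exists (a :: p1), p2.
case=> -[|a' p1] [p2 [-> D]]; first by case: D => ->; rewrite eqxx.
by apply/orP; right; apply/IHs; exists p1, p2.
Qed.

Lemma path_edgesP a b x : x \in path_edges e a b <->
  exists p1 p2 y z, tpath e a b = p1 ++ [:: y, z & p2] /\ x = [set y; z].
Proof.
split=> [/imsetP[[y z] /mem_zip_behead[p1 [p2 D]] ->]|].
  by exists p1, p2, y, z.
case=> p1 [p2 [y [z [D ->]]]]; apply/imsetP; exists (y, z) => //.
by apply/mem_zip_behead; exists p1, p2.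
Qed.

(** A path whose ends are separated must cross the edge above [c]. Conversely, a second crossing
    would visit an end of that edge again. *)
Lemma par_edge_path a b c : c != r ->
  (par_edge c \in path_edges e a b) = (ancestor e r c a != ancestor e r c b).
Proof.
move=> cr; apply/idP/idP => [/path_edgesP|neq]; last first.
  have [p Dp /and3P[pp _ /eqP Lp]] := tpathP a b.
  move: neq; rewrite -{1}Lp => /(path_crosses pp)[p1 [p2 [y [z [D1 D2]]]]].
  by apply/path_edgesP; exists p1, p2, y, z; rewrite Dp.
case=> p1 [p2 [y [z [Dp Dc]]]].
have [_ _ syz Ha _] := tpath_split Dp.
have /tpath_split[Up s1 s2 _ Lb] : tpath e a b = rcons p1 y ++ z :: p2.
  by rewrite cat_rcons.
have eyz : e y z by case/andP: syz.
have : ancestor e r c y != ancestor e r c z by rewrite ancestor_step // Dc.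
have yz_c : (y == c) || (y == tpar c).
  by have: y \in par_edge c by [rewrite Dc set21]; rewrite !inE.
have zz_c : (z == c) || (z == tpar c).
  by have: z \in par_edge c by [rewrite Dc set22]; rewrite !inE.
move: Up; rewrite cat_uniq => /and3P[_ /hasPn Np2 _].
have /eqP -> : ancestor e r c a == ancestor e r c y.
  apply: contraT => neq; case: (@sorted_crosses c y (rcons p1 y)).
  - by move: s1; rewrite -cats1 => /cat_sorted2[].
  - by rewrite Ha last_rcons.
  move=> cp pcp; have /= := Np2 z (mem_head _ _).
  by case/orP: zz_c => /eqP ->; rewrite ?cp ?pcp.
have /eqP -> // : ancestor e r c z == ancestor e r c b.
apply: contraT => neq; case: (sorted_crosses (x := z) s2 (c := c)).
  by rewrite /= Lb.
have yp : y \in rcons p1 y by rewrite mem_rcons mem_head.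
move=> cp pcp; case/orP: yz_c => /eqP Dy; move: (Np2 y).
  by rewrite /= yp Dy => /(_ cp).
by rewrite /= yp Dy => /(_ pcp).
Qed.

Lemma path_edges_par a b x : x \in path_edges e a b ->
  exists2 c, c != r & x = par_edge c.
Proof.
case/path_edgesP=> p1 [p2 [y [z [/tpath_split[_ _ syz _ _] ->]]]].
apply: edges_par_edge; apply/imsetP; exists (y, z) => //.
by rewrite inE; case/andP: syz.
Qed.

(** * Apexes of links and the edges they cover *)

Lemma ancestor_antiN x y z : ancestor e r x z -> ancestor e r y z ->
  ~~ ancestor e r y x -> ancestor e r x y.
Proof. by move=> xz yz yNx; case/orP: (ancestor_total xz yz); rewrite ?(negPf yNx). Qed.

(** The least common ancestor of [l], found as the common ancestor with the longest root path. *)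
Definition apex (l : {set V}) :=
  [arg max_(x > r | [forall a in l, ancestor e r x a]) size (tp x)].

(* For empty l the apex is a junk value and span_verts l is empty. *)
Definition span_verts (l : {set V}) :=
  [set x | ancestor e r (apex l) x && [exists a in l, ancestor e r x a]].

Lemma apexP (l : {set V}) : {in l, forall a, ancestor e r (apex l) a} /\
  (l != set0 ->
   forall x, {in l, forall a, ancestor e r x a} -> ancestor e r x (apex l)).
Proof.
rewrite /apex; case: arg_maxnP => [|m /forall_inP ml max_m].
  by apply/forall_inP=> a _; apply: ancestor_root.
split=> // /set0Pn[a al] x xl; apply: contraT => xNm.
have /ancestor_take[s Ds] := ancestor_antiN (ml a al) (xl a al) xNm.
have le_xm : size (tp x) <= size (tp m) by apply/max_m/forall_inP.
move: le_xm; rewrite {1}Ds size_cat -[leqRHS]addn0 leq_add2l leqn0 size_eq0.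
move/eqP=> s0; rewrite s0 cats0 in Ds.
by rewrite -(tp_last x r) Ds tp_last ancestor_refl in xNm.
Qed.

(** Through this inclusion, bounds on the number of links at a vertex pass from [span_verts] to
    [link_verts]. *)
Lemma link_verts_span l : link_verts e l \subset span_verts l.
Proof.
apply/subsetP=> v /bigcupP[a al /bigcupP[b bl]] /path_vertsP[lca vab].
have [ml _] := apexP l; rewrite inE lca ?ml //=; apply/exists_inP.
by case: vab; [exists a | exists b].
Qed.

(** Both sides say that the subtree of [c] contains some but not all vertices of [l]. *)
Lemma par_edge_link l c : c != r ->
  (par_edge c \in link_edges e l) = (c \in span_verts l) && ~~ ancestor e r c (apex l).
Proof.
move=> cr; have [ml lcal] := apexP l; apply/idP/andP.
  case/bigcupP=> a al /bigcupP[b bl]; rewrite par_edge_path //.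
  wlog ca : a b al bl / ancestor e r c a => [IH | ].
    have [ca|cNa] := boolP (ancestor e r c a).
      by move: (IH a b al bl ca); rewrite ca.
    rewrite eq_sym eqbF_neg negbK => cb.
    by move: (IH b a bl al cb); rewrite cb (negPf cNa) => /(_ isT).
  rewrite ca eq_sym eqb_id => cNb.
  have cNm : ~~ ancestor e r c (apex l).
    by apply: contra cNb => /ancestor_trans; apply; apply: ml.
  split=> //; rewrite inE (ancestor_antiN (ml a al) ca cNm); apply/exists_inP.
  by exists a.
case; rewrite inE => /andP[_ /exists_inP[a al ca]] cNm.
have [/exists_inP[b bl cNb] | none] := boolP [exists b in l, ~~ ancestor e r c b].
  apply/bigcupP; exists a => //; apply/bigcupP; exists b => //.
  by rewrite par_edge_path // ca (negPf cNb).
case/negP: cNm; apply: lcal; first by apply/set0Pn; exists a.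
by move=> b bl; apply: contraNT none => cNb; apply/exists_inP; exists b.
Qed.

Lemma par_edge_up_path u c : ancestor e r u.1 u.2 -> c != r ->
  (par_edge c \in up_path e u) = ancestor e r c u.2 && ~~ ancestor e r c u.1.
Proof.
move=> u12 cr; rewrite par_edge_path //; have := @ancestor_trans u.1 c u.2.
by case: (ancestor _ _ c u.1) => [/(_ isT u12) ->|]; case: (ancestor _ _ c u.2).
Qed.

End RootedTree.

(** * Splitting a family of links into thin parts *)

(** Iterating [G] stabilises at [x] after more than [m x] rounds. This provides recursion along the
    parents of links. *)
Lemma measure_rec (T A : Type) (m : T -> nat) (a0 : A) (G : (T -> A) -> T -> A) :
    (forall g g' x, (forall y, m y < m x -> g y = g' y) -> G g x = G g' x) ->
  exists g, forall x, g x = G g x.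
Proof.
move=> Gext; pose it n := iter n G (fun=> a0).
have itE n n' x : m x < n -> m x < n' -> it n x = it n' x.
  elim: n n' x => [|n IHn] [|n'] x // ltn ltn'.
  apply: Gext => y lt_yx; apply: IHn; exact: leq_trans lt_yx _.
exists (fun x => it (m x).+1 x) => x.
by apply: Gext => y lt_yx; apply: itE.
Qed.

Lemma mod_window a k i : i < k -> exists2 j, a <= j < a + k & j %% k = i.
Proof.
move=> lt_ik; have k_gt0 : 0 < k by apply: leq_ltn_trans lt_ik.
(* The offset is the residue of [i - a], with [k - a %% k] standing for the negative term. *)
exists (a + (i + (k - a %% k)) %% k); first by rewrite leq_addr ltn_add2l ltn_mod.
have le_mk : a %% k <= k by rewrite ltnW // ltn_mod.
by rewrite modnDmr -modnDml addnCA (subnKC le_mk) modnDr modn_small.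
Qed.

(** * The abstract setting: links and disjoint vertical paths in a tree order *)

Section Thinning.
Variables (V I W : finType) (le : rel V).
Hypotheses (le_refl : reflexive le) (le_trans : transitive le)
  (le_anti : antisymmetric le)
  (le_total : forall x y z, le x z -> le y z -> le x y || le y x).
Variables (F : {set I}) (apex : I -> V) (S : I -> {set V}).
Hypotheses (S_apex : forall f x, x \in S f -> le (apex f) x)
  (S_convex : forall f x y, le (apex f) x -> le x y -> y \in S f -> x \in S f).
Variables (U : {set W}) (top bot : W -> V).

Definition on_path u c := le c (bot u) && ~~ le c (top u).
(* A vertex stands for the edge to its parent, here and in on_path. *)
Definition covers f c := (c \in S f) && ~~ le c (apex f).

Hypotheses (le_top : {in U, forall u, le (top u) (bot u)})
  (on_bot : {in U, forall u, ~~ le (bot u) (top u)})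
  (U_disj : {in U &, forall u v c, on_path u c -> on_path v c -> u = v})
  (F_cov : {in U, forall u c, on_path u c -> exists2 f, f \in F & covers f c}).

Definition covering (X : {set I}) u :=
  [forall c, on_path u c ==> [exists f in X, covers f c]].

Lemma coveringP (X : {set I}) u :
  reflect (forall c, on_path u c -> exists2 f, f \in X & covers f c) (covering X u).
Proof.
apply: (iffP forallP) => [cov c uc | cov c].
  by have := cov c; rewrite uc => /exists_inP.
by apply/implyP=> /cov ?; apply/exists_inP.
Qed.

(* The constant term makes any link lighter than two links together, so that
   covers of minimum weight first of all have minimum cardinality. *)
Definition weight f := #|V|.+1 + #|[set y | ~~ le y (apex f)]|.
Definition cover u :=
  [arg min_(X < F | covering X u && (X \subset F)) \sum_(f in X) weight f].

Lemma coverP u : u \in U ->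
  [/\ cover u \subset F, covering (cover u) u
    & forall X : {set I}, X \subset F -> covering X u ->
        \sum_(f in cover u) weight f <= \sum_(f in X) weight f].
Proof.
move=> uU; rewrite /cover; case: arg_minnP.
  by rewrite subxx andbT; apply/coveringP; apply: F_cov.
by move=> X /andP[covX sXF] minX; split=> // Y sYF covY; apply: minX; rewrite sYF covY.
Qed.

Definition below x y := le x y && (x != y).

Lemma belowN x y z : le x z -> le y z -> ~~ le y x -> below x y.
Proof.
move=> xz yz Nyx; rewrite /below; have /orP[-> | /idPn] := le_total xz yz => //.
by apply: contraNneq Nyx => ->.
Qed.

Lemma below_leF x y : below x y -> le y x = false.
Proof. by case/andP=> xy; apply: contraNF => yx; rewrite (@le_anti x y) ?xy. Qed.

Definition depth x := #|[set y | le y x]|.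

Lemma depth_below x y : below x y -> depth x < depth y.
Proof.
move=> xy; apply/proper_card/properP; split.
  by apply/subsetP=> z; rewrite !inE => /le_trans; apply; case/andP: xy.
by exists y; rewrite !inE ?le_refl // below_leF.
Qed.

Lemma weight_below f g : below (apex f) (apex g) -> weight g < weight f.
Proof.
move=> fg; rewrite ltn_add2l; apply/proper_card/properP; split.
  apply/subsetP=> z; rewrite !inE; apply: contra => /le_trans; apply.
  by case/andP: fg.
by exists (apex g); rewrite !inE ?le_refl // below_leF.
Qed.

(** Weights lie between [#|V| + 1] and [2 * #|V| + 1]. *)
Lemma weight_lt_add f g h : weight f < weight g + weight h.
Proof.
apply: (@leq_trans (#|V|.+1 + #|V|.+1)); last by rewrite leq_add ?leq_addr.
by rewrite ltn_add2l ltnS max_card.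
Qed.

(** * Exchange properties of a minimum cover *)

Section OneCover.
Variable u : W.
Hypothesis uU : u \in U.

(** Swapping [A] for [B] in the cover of [u] would give a lighter cover. Every later use of
    minimality goes through this exchange. *)
Lemma cover_exchange (A B : {set I}) :
    A \subset cover u -> B \subset F ->
    \sum_(f in B) weight f < \sum_(f in A) weight f ->
    (forall f c, f \in A -> on_path u c -> covers f c ->
       exists2 g, g \in B :|: (cover u :\: A) & covers g c) ->
  False.
Proof.
move=> sAC sBF ltBA AB; have [sCF /coveringP covC minC] := coverP uU.
have sXF : B :|: (cover u :\: A) \subset F.
  by rewrite subUset sBF (subset_trans (subsetDl _ _)).
have covX : covering (B :|: (cover u :\: A)) u.
  apply/coveringP=> c uc; have [g gC gc] := covC c uc.
  have [gA | gNA] := boolP (g \in A); first exact: AB gA uc gc.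
  by exists g; rewrite // !inE gNA gC orbT.
have := minC _ sXF covX; rewrite leqNgt => /negP[].
rewrite [X in _ < X](big_setID A) /= (setIidPr sAC).
apply: (@leq_ltn_trans
  (\sum_(f in B) weight f + \sum_(f in cover u :\: A) weight f)); last first.
  by rewrite ltn_add2r.
rewrite !(big_mkcond (fun f => f \in _)) -big_split /=; apply: leq_sum => f _.
by rewrite in_setU; case: (f \in B); case: (f \in _ :\: _); rewrite /= ?leq_addr.
Qed.

Lemma cover_private f g : f \in cover u -> g \in cover u -> f != g ->
  exists c, [/\ on_path u c, covers g c & ~~ covers f c].
Proof.
move=> fC gC neq_fg.
have [/existsP[c /and3P[]]|none] :=
  boolP [exists c, [&& on_path u c, covers g c & ~~ covers f c]]; first by exists c.
case: (@cover_exchange [set g] set0); rewrite ?sub1set ?sub0set ?big_set0 ?big_set1 //.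
move=> _ c /set1P-> uc gc; exists f; first by rewrite !inE neq_fg fC.
by apply: contraNT none => fNc; apply/existsP; exists c; rewrite uc gc.
Qed.

Lemma cover_meets f : f \in cover u -> exists2 c, on_path u c & covers f c.
Proof.
move=> fC; have [/exists_inP[] |none] := boolP [exists c in on_path u, covers f c].
  by move=> c; exists c.
case: (@cover_exchange [set f] set0); rewrite ?sub1set ?sub0set ?big_set0 ?big_set1 //.
by move=> _ c /set1P-> uc fc; case/exists_inP: none; exists c.
Qed.

(* Both links meet the path in an interval; as neither interval contains the
   other, the one that starts later also ends later. *)
Lemma cover_deep f g c :
    f \in cover u -> g \in cover u -> f != g ->
    (forall x, on_path u x -> covers g x -> ~~ le x (apex f)) ->
    on_path u c -> covers f c -> ~~ le c (apex g) ->
  covers g c.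
Proof.
move=> fC gC neq_fg start uc fc cNg.
have [x [ux gx fNx]] := cover_private fC gC neq_fg.
have xNf := start x ux gx.
have [cf cNf] := andP fc; have [xg xNg] := andP gx.
have [xb _] := andP ux; have [cb _] := andP uc.
rewrite /covers cNg andbT.
have /orP[xc | cx] := le_total xb cb.
  case/negP: fNx; rewrite /covers xNf andbT; apply: (S_convex _ xc cf).
  by case/andP: (belowN (le_trans (S_apex cf) cb) xb xNf).
apply: (S_convex _ cx xg).
by case/andP: (belowN (le_trans (S_apex xg) xb) cb cNg).
Qed.

(** When the apexes look alike from the path, [cover_deep] forces [f] to cover even an edge that is
    covered by [g] and not by [f]. *)
Lemma cover_inj f g : f \in cover u -> g \in cover u ->
  (forall c, on_path u c -> le c (apex f) = le c (apex g)) -> f = g.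
Proof.
move=> fC gC Efg; apply/eqP/contraT => neq_fg.
have [c [uc gc /negP[]]] := cover_private fC gC neq_fg.
have [_ cNg] := andP gc.
rewrite eq_sym in neq_fg.
apply: (cover_deep gC fC neq_fg _ uc gc); last by rewrite Efg.
by move=> x ux /andP[_]; rewrite Efg.
Qed.

Lemma on_path_leF c x : on_path u c -> le x (top u) -> le c x = false.
Proof. by case/andP=> _ + xt; apply: contraNF => /le_trans; apply. Qed.

Lemma cover_top_inj f g : f \in cover u -> g \in cover u ->
  le (apex f) (top u) -> le (apex g) (top u) -> f = g.
Proof.
move=> fC gC ft gt; apply: cover_inj => // c uc.
by rewrite (on_path_leF uc ft) (on_path_leF uc gt).
Qed.

Lemma cover_apex f : f \in cover u -> le (apex f) (bot u).
Proof.
by case/cover_meets=> c /andP[cb _] /andP[/S_apex fc _]; apply: le_trans cb.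
Qed.

Lemma cover_top : exists2 h, h \in cover u & le (apex h) (top u).
Proof.
have [_ /coveringP covC _] := coverP uU.
have ub : on_path u (bot u) by rewrite /on_path le_refl on_bot.
(* [c] is the topmost edge of the path. If the link [h] covering it started below the top, its apex
   would stand for an edge of the path above [c]. *)
case: (arg_minnP depth ub) => c uc minc; have [h hC hc] := covC c uc.
exists h => //; apply: contraT => hNt; have [cS cNh] := andP hc.
have /minc : on_path u (apex h) by rewrite /on_path cover_apex.
by rewrite leqNgt (depth_below (belowN (S_apex cS) (le_refl c) cNh)).
Qed.

End OneCover.

(** * The forest of links: owners, parents and levels *)

Definition owner f := [pick u in U | (f \in cover u) && on_path u (apex f)].

(** [U_disj] leaves at most one path through the edge above the apex, and [cover_top_inj] at most
    one [h], so neither choice is arbitrary. [None] marks a root of the forest. *)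
Definition parent f :=
  if owner f is Some u then [pick h in cover u | le (apex h) (top u)] else None.

Lemma parentP f h : parent f = Some h ->
  exists u, [/\ u \in U, f \in cover u, on_path u (apex f), h \in cover u
               & le (apex h) (top u)].
Proof.
rewrite /parent /owner; case: pickP => // u /and3P[uU fC uf].
by case: pickP => // h' /andP[hC ht] [<-]; exists u.
Qed.

Lemma parent_cover u f h : u \in U -> f \in cover u -> h \in cover u ->
  on_path u (apex f) -> le (apex h) (top u) -> parent f = Some h.
Proof.
move=> uU fC hC uf ht; rewrite /parent /owner.
case: pickP => [v /and3P[vU fCv vf] | /(_ u)]; last by rewrite uU fC uf.
rewrite -(U_disj uU vU uf vf).
case: pickP => [h' /andP[hC' ht'] | /(_ h)]; last by rewrite hC ht.
by congr Some; apply: cover_top_inj ht' ht.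
Qed.

Lemma parent_below f h : parent f = Some h -> below (apex h) (apex f).
Proof.
case/parentP=> u [uU _ uf hC ht]; have [fb _] := andP uf.
by apply: belowN fb _; rewrite ?cover_apex // (on_path_leF uf).
Qed.

Lemma coversI f x c : x \in S f -> le c x -> ~~ le c (apex f) -> covers f c.
Proof.
move=> fx cx cNf; rewrite /covers cNf andbT; apply: (S_convex _ cx fx).
by case/andP: (belowN (S_apex fx) cx cNf).
Qed.

Lemma ex_level : exists level, forall f,
  level f = if parent f is Some h then (level h).+1 else 0.
Proof.
apply: (measure_rec (m := depth \o apex) 0) => g g' f Egg'.
by case Df: (parent f) => [h|] //; rewrite Egg' //; apply/depth_below/parent_below.
Qed.

(** * Components left after deleting one label class *)

Section Components.
Variables (k i : nat) (level : I -> nat) (root : I -> I).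
Hypothesis levelE : forall f,
  level f = if parent f is Some h then (level h).+1 else 0.
(** Arcs to a parent whose level is [i] modulo [k] are deleted; [root f] is where the climb from [f]
    along the remaining arcs stops. *)
Hypothesis rootE : forall f,
  root f = if parent f is Some h then if level h %% k == i then f else root h
           else f.

Lemma root_step f :
  root f = f \/ exists h, [/\ parent f = Some h, level h %% k != i,
                            root h = root f & level f = (level h).+1].
Proof.
rewrite rootE levelE; case Df: (parent f) => [h|]; last by left.
by case: eqP => [_|/eqP]; [left | right; exists h].
Qed.

Lemma depth_ind (P : I -> Prop) :
    (forall f, (forall g, below (apex g) (apex f) -> P g) -> P f) ->
  forall f, P f.
Proof.
move=> IH f; have [n] := ubnP (depth (apex f)); elim: n f => // n IHn f lt_f.
by apply: IH => g /depth_below lt_gf; apply: IHn; apply: leq_trans lt_gf _.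
Qed.

Lemma below_trans : transitive below.
Proof.
move=> y x z xy yz; rewrite /below; have [xy' _] := andP xy; have [yz' _] := andP yz.
rewrite (le_trans xy' yz') /=; apply: contraTneq yz' => <-.
by rewrite below_leF.
Qed.

Lemma root_below f : root f != f ->
  below (apex (root f)) (apex f) /\ level (root f) < level f.
Proof.
elim/depth_ind: f => f IHf; case: (root_step f) => [->|[h [fh _ <- ->]] _].
  by rewrite eqxx.
have hf := parent_below fh; have [->|/(IHf _ hf)[rh lt_rh]] := eqVneq (root h) h.
  by [].
by split; [apply: below_trans rh hf | apply: ltnW].
Qed.

Lemma level_root f : level (root f) <= level f.
Proof. by have [->|/root_below[_ /ltnW]] := eqVneq (root f) f. Qed.

(** Each level in this range is that of the parent end of a surviving arc on the climb from [f] to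
    its root. *)
Lemma root_levels f j : level (root f) <= j < level f -> j %% k != i.
Proof.
elim/depth_ind: f j => f IHf j; case: (root_step f) => [->|[h [fh hNi <- ->]]].
  by case/andP=> /leq_ltn_trans lt /lt; rewrite ltnn.
rewrite ltnS => /andP[le_rj]; rewrite leq_eqVlt => /orP[/eqP-> //|lt_jh].
by apply: (IHf _ (parent_below fh)); rewrite le_rj.
Qed.

(** A longer climb would pass a level that is [i] modulo [k], where the arc is deleted. *)
Lemma level_window f : i < k -> level f < level (root f) + k.
Proof.
move=> lt_ik; rewrite ltnNge; apply/negP=> le_f.
have [j /andP[le_j lt_j] Dj] := mod_window (level (root f)) lt_ik.
by have := @root_levels f j; rewrite le_j (leq_trans lt_j) // Dj eqxx => /(_ isT).
Qed.

(** A component root has its apex strictly above all others of its component. Two other links with a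
    common apex have the same owner, and [cover_inj] identifies them. *)
Lemma root_apex_inj f g : root f = root g -> apex f = apex g -> f = g.
Proof.
have root_case f' g' :
    root f' = root g' -> apex f' = apex g' -> root f' = f' -> f' = g'.
  move=> Er Ea Df; apply/eqP; rewrite -Df Er; apply: contraT => /root_below[].
  by rewrite -Er Df -Ea /below eqxx andbF.
move=> Er Ea; case: (root_step f) => [|[h [fh _ _ _]]]; first exact: root_case.
case: (root_step g) => [Dg|[h' [gh' _ _ _]]]; first exact/esym/root_case.
have [u [uU fC uf _ _]] := parentP fh; have [u' [u'U gC ug _ _]] := parentP gh'.
rewrite -Ea in ug; rewrite -(U_disj uU u'U uf ug) in gC.
by apply: (cover_inj uU fC gC) => c _; rewrite Ea.
Qed.

(* If p has its apex above P_u, then so has h_u, and by the weight of F_u the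
   apex of h_u is not above that of p; this gives the induction on q. *)
Lemma root_chain p q v : p \in F -> root p = root q -> v \in S p -> v \in S q ->
    below (apex p) (apex q) ->
  exists u, [/\ u \in U, q \in cover u, on_path u (apex q)
    & [/\ p \in cover u, on_path u (apex p) & level p = level q]
      \/ le (apex p) (top u) /\ level p < level q].
Proof.
elim/depth_ind: q p v => q IHq p v pF Er pv qv pq.
have [Dq|[h [qh _ rh lq]]] := root_step q.
  have [Dp|/root_below[]] := eqVneq (root p) p.
    by rewrite -Dq -Er Dp /below eqxx andbF in pq.
  by rewrite Er Dq => /below_trans/(_ pq); rewrite /below eqxx andbF.
have [u [uU qC uq hC ht]] := parentP qh; have hq := parent_below qh.
have [pq' _] := andP pq; have [qb _] := andP uq.
have pb : le (apex p) (bot u) := le_trans pq' qb.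
exists u; split=> //; have [pt|pNt] := boolP (le (apex p) (top u)); last first.
  have up : on_path u (apex p) by rewrite /on_path pb.
  (* The apex of [p] lies on the path, strictly below that of [h]. So [p] is not the component root,
     its owner is [u] as well, and [h] is the parent of both [p] and [q]. *)
  left; have [Dp|[h' [ph' _ _ lp]]] := root_step p.
    have hr : below (apex h) (apex p).
      by apply: (belowN _ pb); rewrite ?(cover_apex uU) // (on_path_leF up).
    have [Dh|/root_below[+ _]] := eqVneq (root h) h.
      by rewrite -Dp Er -rh Dh /below eqxx andbF in hr.
    rewrite rh -Er Dp => /below_trans/(_ hr); by rewrite /below eqxx andbF.
  have [u' [u'U pC u'p h'C h't]] := parentP ph'.
  move: pC h'C h't; rewrite -(U_disj uU u'U up u'p) => pC h'C h't.
  by rewrite lp lq (cover_top_inj uU hC h'C ht h't).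
right; split=> //; rewrite lq ltnS.
have tq : le (top u) (apex q).
  by case/andP: (belowN (le_top uU) qb (negbT (on_path_leF uq (le_refl _)))).
(* [p] and [h] both contain [top u], which takes over the role of [v] in the induction. *)
have pt_S : top u \in S p := S_convex pt (le_trans tq (S_apex qv)) pv.
have [c uc /andP[hc _]] := cover_meets uU hC.
have tc : le (top u) c.
  by case/andP: (belowN (le_top uU) (andP uc).1 (negbT (on_path_leF uc (le_refl _)))).
have ht_S : top u \in S h := S_convex ht tc hc.
have hF : h \in F by have [/subsetP/(_ h hC)] := coverP uU.
have neq_hq : h != q by apply: contraTneq hq => ->; rewrite /below eqxx andbF.
have [hp|] := boolP (le (apex p) (apex h)).
  have [Ea|neq] := eqVneq (apex p) (apex h).
    by rewrite (root_apex_inj (etrans Er (esym rh)) Ea).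
  have : below (apex p) (apex h) by rewrite /below hp.
  case/(IHq h hq p _ pF (etrans Er (esym rh)) pt_S ht_S)=> ? [_ _ _].
  by case=> [[_ _ ->]|[_ /ltnW]].
(* If [h] started above [p], the lighter [p] could replace it: [p] covers the path down to the apex
   of [q], and [q] covers whatever [h] covers beyond. *)
move=> pNh; case: (@cover_exchange u uU [set h] [set p]); rewrite ?sub1set ?big_set1 //.
  exact: weight_below (belowN ht pt pNh).
move=> _ x /set1P-> ux hx; have [xq|xNq] := boolP (le x (apex q)).
  exists p; first by rewrite !inE eqxx.
  by apply: (coversI pv); rewrite ?(le_trans xq (S_apex qv)) ?(on_path_leF ux).
exists q; first by rewrite !inE (eq_sym q h) neq_hq qC orbT.
by apply: (cover_deep uU hC qC neq_hq _ ux hx xNq) => y uy _; rewrite (on_path_leF uy).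
Qed.

(* Otherwise f and g lie in the same F_u; the link p, which covers P_u between
   the apices of f and g, could replace f, or f and h_u together. *)
Lemma root_level_inj p f g v : p \in F -> f \in F ->
    root p = root f -> root f = root g -> v \in S p -> v \in S f -> v \in S g ->
  below (apex p) (apex f) -> below (apex f) (apex g) -> level f != level g.
Proof.
move=> pF fF rpf rfg pv fv gv pf fg; apply/eqP=> lfg.
have [u [uU gC ug [[fC uf _]|[_]]]] := root_chain fF rfg fv gv fg; last first.
  by rewrite lfg ltnn.
have neq_fg : f != g by apply: contraTneq fg => ->; rewrite /below eqxx andbF.
have neq_pf : p != f by apply: contraTneq pf => ->; rewrite /below eqxx andbF.
(* Below its own apex, [p] covers the path as far as the apex of [g]; from there on [g], which
   starts after [h], covers whatever [h] does. *)
have exch h c : h \in cover u -> h != g -> below (apex h) (apex g) ->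
    on_path u c -> covers h c -> ~~ le c (apex p) ->
  covers p c \/ covers g c.
  move=> hC neq hg uc hc cNp; have [cg|cNg] := boolP (le c (apex g)).
    by left; apply: (coversI pv) => //; apply: le_trans cg (S_apex gv).
  right; apply: (cover_deep uU hC gC neq _ uc hc cNg) => x _ /andP[_].
  by apply: contra => /le_trans; apply; case/andP: hg.
have cNp h c : le (apex p) (apex h) -> covers h c -> ~~ le c (apex p).
  by move=> ph /andP[_]; apply: contra => /le_trans; apply.
have [u' [u'U fC' u'f]] := root_chain pF rpf pv fv pf.
(* If [p] lies in the same cover, [f] is redundant. If [p] starts above the path, it replaces both
   [f] and the top link [h], and [weight_lt_add] makes this a gain. *)
rewrite -(U_disj uU u'U uf u'f) => -[[pC _ _]|[pt _]].
  case: (@cover_exchange u uU [set f] set0);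
    rewrite ?sub1set ?sub0set ?big_set0 ?big_set1 //.
  move=> _ c /set1P-> uc fc.
  have /(exch f c fC neq_fg fg uc fc)[pc|gc] : ~~ le c (apex p).
  - by apply: cNp fc; case/andP: pf.
  - by exists p; rewrite // !inE neq_pf pC.
  by exists g; rewrite // !inE eq_sym neq_fg gC.
have [h hC ht] := cover_top uU.
have hf : below (apex h) (apex f).
  apply: belowN (andP uf).1 _; rewrite ?(cover_apex uU) //.
  by rewrite (on_path_leF uf).
have neq_fh : f != h by apply: contraTneq hf => ->; rewrite /below eqxx andbF.
have hg := below_trans hf fg.
have neq_hg : h != g by apply: contraTneq hg => ->; rewrite /below eqxx andbF.
case: (@cover_exchange u uU [set f; h] [set p]).
- by rewrite subUset !sub1set fC.
- by rewrite sub1set.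
- by rewrite big_setU1 ?inE //= !big_set1 weight_lt_add.
move=> f' c f'fh uc f'c.
have [f'C neq f'g] : [/\ f' \in cover u, f' != g & below (apex f') (apex g)].
  by case/set2P: f'fh => ->.
case: (exch f' c f'C neq f'g uc f'c); first by rewrite (on_path_leF uc).
  by exists p; rewrite // !inE eqxx.
by exists g; rewrite // !inE gC !(eq_sym g) (negPf neq_fg) (negPf neq_hg) !orbT.
Qed.

(** [q] has the highest apex among the links counted; [root_level_inj] separates the others by
    level, so [phi] is injective into the numbers below [k]. *)
Lemma root_thin z v : i < k -> #|[set f in F | (root f == z) && (v \in S f)]| <= k.
Proof.
move=> lt_ik; set X := [set f in F | _].
have [->|[f0 f0X]] := set_0Vmem X; first by rewrite cards0.
case: (arg_minnP (depth \o apex) f0X) => q qX min_q {f0 f0X}.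
have XP f : f \in X -> [/\ f \in F, root f = z & v \in S f].
  by rewrite inE => /and3P[fF /eqP].
have qbelow f : f \in X -> f != q -> below (apex q) (apex f).
  move=> fX neq_fq; have [fF rf fv] := XP f fX; have [qF rq qv] := XP q qX.
  have [qf|] := boolP (le (apex q) (apex f)).
    rewrite /below qf; apply: contra neq_fq => /eqP Ea.
    by apply/eqP/root_apex_inj; rewrite ?rf ?rq.
  move/(belowN (S_apex fv) (S_apex qv))/depth_below.
  by rewrite ltnNge min_q.
(* The value 0 is free for [q], since every other link has a level above that of [z]. *)
pose phi f := if f == q then 0 else level f - level z.
have phi_lt f : f \in X -> phi f < k.
  move=> fX; rewrite /phi; case: ifP => _; first exact: leq_ltn_trans lt_ik.
  have [_ rf _] := XP f fX; rewrite ltn_subLR -rf ?level_root //.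
  exact: level_window.
have lev_gt f : f \in X -> f != q -> level z < level f.
  move=> fX neq_fq; have [_ rf _] := XP f fX; have [_ rq _] := XP q qX.
  rewrite -rf; apply: (root_below _).2; apply: contraTneq (qbelow f fX neq_fq) => Df.
  have [Dq|/root_below[+ _]] := eqVneq (root q) q.
    by rewrite -Df rf -rq Dq /below eqxx andbF.
  by rewrite rq -rf Df => /andP[+ _]; apply: contraL => /below_leF->.
have phi_inj : {in X &, injective phi}.
  move=> f g fX gX; rewrite /phi.
  have lt0 h : h \in X -> h != q -> level h - level z != 0.
    by move=> hX hq; rewrite -lt0n subn_gt0 lev_gt.
  have [->|fq] := eqVneq f q; have [->|gq] := eqVneq g q => //.
  - by move/esym/eqP/negPn; rewrite lt0.
  - by move/eqP/negPn; rewrite lt0.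
  move/(congr1 (addn^~ (level z))).
  rewrite (subnK (ltnW (lev_gt f fX fq))) (subnK (ltnW (lev_gt g gX gq))) => lfg.
  have [qF rq qv] := XP q qX.
  wlog fg : f g fX gX fq gq lfg / le (apex f) (apex g) => [IH|].
    have [_ _ fv] := XP f fX; have [_ _ gv] := XP g gX.
    case/orP: (le_total (S_apex fv) (S_apex gv)) => ?; first exact: IH.
    exact/esym/IH.
  have [fF rf fv] := XP f fX; have [_ rg gv] := XP g gX.
  have [Ea|neq] := eqVneq (apex f) (apex g); first by apply: root_apex_inj; rewrite ?rf.
  have bfg : below (apex f) (apex g) by rewrite /below fg.
  have := root_level_inj qF fF (etrans rq (esym rf)) (etrans rf (esym rg)) qv fv gv.
  by rewrite lfg eqxx => /(_ (qbelow f fX fq) bfg).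
rewrite cardE -(size_map phi) -(size_iota 0 k); apply: uniq_leq_size.
  rewrite map_inj_in_uniq ?enum_uniq // => f g; rewrite !mem_enum; exact: phi_inj.
by move=> n /mapP[f]; rewrite mem_enum mem_iota => fX ->; apply: phi_lt.
Qed.

End Components.

(** The labels are fixed before [i], so that the class to delete can be chosen afterwards by its
    cost. *)
Theorem thin_partition k : 0 < k ->
  exists2 lab : W -> nat, forall u, lab u < k
    & forall i, i < k -> exists Zs : {set {set I}},
        [/\ partition Zs F,
            {in Zs, forall (Z : {set I}) v, #|[set f in Z | v \in S f]| <= k}
          & {in U, forall u, lab u != i -> exists2 Z, Z \in Zs & covering Z u}].
Proof.
move=> k_gt0; have [level levelE] := ex_level.
(* The level of the top link of the cover, modulo [k]; by [cover_top] the default 0 never arises for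
   [u] in [U]. *)
exists (fun u => if [pick h in cover u | le (apex h) (top u)] is Some h
                 then level h %% k else 0).
  by move=> u; case: pickP => // h _; rewrite ltn_mod.
move=> i lt_ik.
have [root rootE] : exists root, forall f, root f =
    if parent f is Some h then if level h %% k == i then f else root h else f.
  have [i0 _ | F0] := pickP I; last by exists id => f; have := F0 f.
  apply: (measure_rec (m := depth \o apex) i0) => g g' f Egg'.
  by case Df: (parent f) => [h|] //; rewrite Egg' //; apply/depth_below/parent_below.
exists (preim_partition root F); split.
- exact: preim_partitionP.
- move=> Z /imsetP[f fF ->] v.
  apply: leq_trans (root_thin levelE rootE (root f) v lt_ik); apply: subset_leq_card.
  by apply/subsetP=> g; rewrite !inE eq_sym andbA.
move=> u uU; case: pickP => [h /andP[hC ht] hNi | none]; last first.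
  by have [h hC ht] := cover_top uU; have := none h; rewrite hC ht.
have [/subsetP sCF /coveringP covC _] := coverP uU.
exists [set g in F | root h == root g].
  by apply/imsetP; exists h; rewrite ?sCF.
apply/coveringP=> c uc; have [f fC fc] := covC c uc; exists f => //.
rewrite inE sCF //= eq_sym; have [-> //|neq_fh] := eqVneq f h.
(* Every other link [f] of the cover has its apex on the path, hence parent [h], and the arc to [h]
   survives because the label of [u] is not [i]. *)
rewrite rootE (@parent_cover u f h) ?(negPf hNi) //.
rewrite /on_path cover_apex //; apply: contra neq_fh => ft.
by rewrite (cover_top_inj uU fC hC).
Qed.

End Thinning.

(** * Averaging over the labels, and the return to Hyper-TAP *)

Local Open Scope ring_scope.

Lemma sum_le_mean (R : realFieldType) (W : finType) (U : {set W}) (c : W -> R)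
    (k : nat) (lab : W -> nat) : (0 < k)%N -> (forall u, (lab u < k)%N) ->
  exists2 i, (i < k)%N
    & k%:R * \sum_(u in [set u in U | lab u == i]) c u <= \sum_(u in U) c u.
Proof.
move=> k_gt0 lab_lt; pose lab' u := Ordinal (lab_lt u).
pose cost (i : 'I_k) := \sum_(u in U | lab' u == i) c u.
case: (@arg_minP _ _ _ (Ordinal k_gt0) xpredT cost) => // i _ min_i; exists i => //.
have -> : \sum_(u in [set u in U | lab u == i]) c u = cost i.
  by apply: eq_bigl => u; rewrite inE.
rewrite (partition_big lab' xpredT) //= mulr_natl -[X in _ *+ X]card_ord -sumr_const.
by apply: ler_sum => j _; apply: min_i.
Qed.

Theorem theorem3 (R : realType) (V : finType) (e : rel V) (r : V)
    (L : {set {set V}}) (cL : {set V} -> R)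
    (U : {set V * V}) (c : V * V -> R) (F : {set {set V}})
    (eps : R) (k : nat) :
  is_tree e ->
  {in L, forall l, 0 <= cL l} ->
  up_link_solution e r U ->
  {in U, forall u, 0 <= c u} ->
  {in U &, forall u v, u != v -> [disjoint up_path e u & up_path e v]} ->
  feasible e L F ->
  0 < eps ->
  k%:Z = Num.ceil (1 / eps) ->
  exists (Zs : {set {set {set V}}}) (O : {set V * V}),
    [/\ partition Zs F,
        O \subset U,
        {in Zs, forall Z, thin e k Z},
        \sum_(u in O) c u <= eps * \sum_(u in U) c u
      & U :\: O \subset \bigcup_(Z in Zs) drop_links e U Z].
Proof.
move=> tree_e _ [U_up U_cov] c_ge0 U_disj [_ F_cov] eps_gt0 Dk.
have inv_gt0 : 0 < 1 / eps by rewrite divr_gt0.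
have k_gt0 : (0 < k)%N by rewrite -ltz_nat Dk ceil_gt0.
have le_k : 1 <= eps * k%:R.
  by rewrite mulrC -ler_pdivrMr // -[k%:R]/(k%:Z%:~R) Dk ceil_ge.
(* The abstract setting is instantiated with the ancestor order, [span_verts] as the vertex set of a
   link, and the ends of an up-link as top and bottom. *)
pose le := ancestor e r.
have le_u u : u \in U -> le u.1 u.2 by case/U_up/andP.
have on_root u x : on_path le fst snd u x -> x != r.
  by case/andP=> _; apply: contraNneq => ->; apply: ancestor_root.
have on_up u x : u \in U -> on_path le fst snd u x -> par_edge e r x \in up_path e u.
  by move=> uU ux; rewrite par_edge_up_path ?(on_root u) //; apply: le_u.
have S_apex f x : x \in span_verts e r f -> le (apex e r f) x by rewrite inE => /andP[].
have S_convex f x y : le (apex e r f) x -> le x y -> y \in span_verts e r f ->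
    x \in span_verts e r f.
  move=> fx xy; rewrite !inE => /andP[_ /exists_inP[a af ya]].
  rewrite [ancestor _ _ _ x]fx; apply/exists_inP; exists a => //.
  exact: ancestor_trans ya.
have on_bot : {in U, forall u, ~~ le u.2 u.1}.
  move=> u uU; have /andP[u12] := U_up u uU; apply: contra => u21.
  by apply/eqP/(ancestor_anti tree_e (r := r)); rewrite u12.
have disj : {in U &, forall u v x,
    on_path le fst snd u x -> on_path le fst snd v x -> u = v}.
  move=> u v uU vU x ux vx; apply/eqP; apply: contraT => neq_uv.
  have /pred0P/(_ (par_edge e r x)) := U_disj u v uU vU neq_uv.
  by rewrite /= !on_up.
have cov_on : {in U, forall u x, on_path le fst snd u x ->
    exists2 f, f \in F & covers le (apex e r) (span_verts e r) f x}.
  move=> u uU x ux; have xr := on_root u x ux.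
  have: par_edge e r x \in covered e F by rewrite F_cov par_edge_edges.
  by case/bigcupP=> f fF; rewrite par_edge_link // => fx; exists f.
have [lab lab_lt thinP] := thin_partition (@ancestor_refl _ _ tree_e r)
  (@ancestor_trans _ _ tree_e r) (@ancestor_anti _ _ tree_e r)
  (@ancestor_total _ _ tree_e r) S_apex S_convex le_u on_bot disj cov_on k_gt0.
have [i lt_ik cost_i] := sum_le_mean U c k_gt0 lab_lt.
have [Zs [partZs thinZs covZs]] := thinP i lt_ik.
exists Zs, [set u in U | lab u == i]; split=> //.
- by apply/subsetP=> u; rewrite inE => /andP[].
- move=> Z ZZs v; apply: leq_trans (thinZs Z ZZs v); apply: subset_leq_card.
  apply/subsetP=> l; rewrite !inE => /andP[-> /=].
  by move/(subsetP (link_verts_span tree_e r l)); rewrite inE.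
(* The chain is c(O) <= eps k c(O) <= eps c(U); the first inequality uses [le_k] and the
   nonnegativity of c(O). *)
- apply: le_trans (_ : _ <= eps * (k%:R * _)) _; last first.
    by rewrite ler_pM2l //; exact: cost_i.
  rewrite mulrA ler_peMl // sumr_ge0 // => u; rewrite inE => /andP[uU _].
  exact: c_ge0.
apply/subsetP=> u; rewrite !inE => /andP[+ uU]; rewrite uU => uNi.
have [Z ZZs /coveringP covZ] := covZs u uU uNi.
apply/bigcupP; exists Z => //; rewrite inE uU; apply/subsetP=> x xu.
have [y yr Dx] := path_edges_par tree_e r xu; rewrite {}Dx in xu *.
have yu : on_path le fst snd u y.
  by rewrite /on_path -(par_edge_up_path tree_e _ yr) //; apply: le_u.
have [f fZ fy] := covZ y yu; apply/bigcupP; exists f => //.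
by rewrite par_edge_link.
Qed.
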